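(* The proof system $\mathbf{EC}^W$ is sound and strongly complete with respect to the class of $(c)$-frames.
   Context: Fix a nonempty set $\mathbf{P}$ of propositional variables, $p\in\mathbf{P}$. $\mathcal{L}(W)$: $\varphi::=p\mid\neg\varphi\mid\varphi\land\varphi\mid W\varphi$; other Boolean connectives are defined as usual. A neighborhood frame is $\langle S,N\rangle$ with $S$ a nonempty set and $N:S\to\mathcal{P}(\mathcal{P}(S))$; a model $\mathcal{M}=\langle S,N,V\rangle$ based on it adds $V:\mathbf{P}\to\mathcal{P}(S)$. With $\varphi^{\mathcal{M}}=\{s\in S\mid\mathcal{M},s\vDash\varphi\}$: $\mathcal{M},s\vDash p$ iff $s\in V(p)$; Boolean connectives as usual; $\mathcal{M},s\vDash W\varphi$ iff $\varphi^{\mathcal{M}}\in N(s)$ and $s\notin\varphi^{\mathcal{M}}$. A $(c)$-frame is one where, for all $s\in S$, $X,Y\in N(s)$ imply $X\cap Y\in N(s)$. The proof system $\mathbf{EC}^W$ for $\mathcal{L}(W)$ has as axioms all instances of propositional tautologies and all instances of $\texttt{WE}$: $W\varphi\to\neg\varphi$ and $\texttt{WC}$: $W\varphi\land W\psi\to W(\varphi\land\psi)$; its rules are modus ponens and $\texttt{REW}$: from $\varphi\leftrightarrow\psi$ infer $W\varphi\leftrightarrow W\psi$ (applied to theorems). Sound with respect to a class of frames: every theorem is true at every state of every model based on a frame in the class. Strongly complete: for every set $\Gamma\cup\{\varphi\}$ of formulas, if $\varphi$ is true at every state, in every model based on a frame in the class, at which all of $\Gamma$ is true, then $\vdash\bigwedge\Gamma_0\to\varphi$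 for some finite $\Gamma_0\subseteq\Gamma$ (equivalently, every consistent set is satisfiable in a model based on a frame in the class). *)

(* Defs.v *)
From Stdlib Require List.
From mathcomp Require Import all_boot.
From mathcomp Require Import boolp classical_sets.

Set Implicit Arguments.
Unset Strict Implicit.
Unset Printing Implicit Defensive.

Local Open Scope classical_set_scope.

(* The language L(W) over an arbitrary type P of propositional variables. *)
Inductive form (P : Type) : Type :=
| Var of P
| Neg of form P
| And of form P & form P
| Wop of form P.

Definition Imp (P : Type) (phi psi : form P) : form P :=
  Neg (And phi (Neg psi)).

Definition Iff (P : Type) (phi psi : form P) : form P :=
  And (Imp phi psi) (Imp psi phi).

(* Verum is not primitive: it is built from a variable p0, which exists because
   the set of variables is nonempty. It is the value of the empty conjunction. *)
Definition Top (P : Type) (p0 : P) : form P := Neg (And (Var p0) (Neg (Var p0))).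

Definition BigAnd (P : Type) (p0 : P) (l : seq (form P)) : form P :=
  foldr (@And P) (Top p0) l.

(* Classes of frames below are predicates [frame -> Prop] and not [set frame]:
   the latter would put the states of a frame in a universe strictly below that
   of [set], so that sets of formulas could not serve as states. *)
Record frame : Type := Frame {
  state :> Type;
  state_nonempty : [set: state] !=set0;
  nbhd : state -> set (set state) }.

Record model (P : Type) : Type := Model {
  model_frame :> frame;
  valuation : P -> set model_frame }.

Fixpoint sat (P : Type) (M : model P) (s : M) (phi : form P) {struct phi} : Prop :=
  match phi with
  | Var p => valuation p s
  | Neg psi => ~ sat s psi
  | And psi chi => sat s psi /\ sat s chi
  | Wop psi => nbhd s [set t : M | sat t psi] /\ ~ [set t : M | sat t psi] s
  end.

Definition c_frame (F : frame) : Prop :=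
  forall (s : F) (X Y : set F), nbhd s X -> nbhd s Y -> nbhd s (X `&` Y).

(* Propositional schemes have their own countable supply of letters, so that
   the stock of tautologies does not depend on the cardinality of P. *)
Inductive pform : Type :=
| PVar of nat
| PNeg of pform
| PAnd of pform & pform.

Fixpoint peval (v : nat -> bool) (a : pform) : bool :=
  match a with
  | PVar i => v i
  | PNeg b => ~~ peval v b
  | PAnd b c => peval v b && peval v c
  end.

Definition tautology (a : pform) : Prop := forall v : nat -> bool, peval v a.

Fixpoint psubst (P : Type) (sigma : nat -> form P) (a : pform) : form P :=
  match a with
  | PVar i => sigma i
  | PNeg b => Neg (psubst sigma b)
  | PAnd b c => And (psubst sigma b) (psubst sigma c)
  end.

Inductive ECW (P : Type) : form P -> Prop :=
| ECW_taut (a : pform) (sigma : nat -> form P) :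
    tautology a -> ECW (psubst sigma a)
| ECW_WE (phi : form P) : ECW (Imp (Wop phi) (Neg phi))
| ECW_WC (phi psi : form P) :
    ECW (Imp (And (Wop phi) (Wop psi)) (Wop (And phi psi)))
| ECW_MP (phi psi : form P) : ECW phi -> ECW (Imp phi psi) -> ECW psi
| ECW_REW (phi psi : form P) :
    ECW (Iff phi psi) -> ECW (Iff (Wop phi) (Wop psi)).

Definition sound (P : Type) (theorem : form P -> Prop) (C : frame -> Prop) : Prop :=
  forall phi : form P, theorem phi ->
  forall M : model P, C M -> forall s : M, sat s phi.

Definition consequence (P : Type) (C : frame -> Prop)
    (Gamma : set (form P)) (phi : form P) : Prop :=
  forall M : model P, C M -> forall s : M,
  (forall gamma : form P, Gamma gamma -> sat s gamma) -> sat s phi.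

(* The finite subset of Gamma is given by a list enumerating it. *)
Definition strongly_complete (P : Type) (p0 : P) (theorem : form P -> Prop)
    (C : frame -> Prop) : Prop :=
  forall (Gamma : set (form P)) (phi : form P), consequence C Gamma phi ->
  exists l : seq (form P),
    (forall gamma : form P, List.In gamma l -> Gamma gamma) /\
    theorem (Imp (BigAnd p0 l) phi).

(* Main.v *)
(* Canonical model: the states are the maximal consistent sets, and the
   neighborhoods of s are the sets |phi| = {t | phi in t} with W phi in s.
   REW makes membership of |phi| in N(s) independent of the choice of phi, and
   since |phi| `&` |psi| = |phi /\ psi|, the axiom WC says exactly that N(s) is
   closed under binary intersections.  Zorn's lemma is needed for Lindenbaum's
   lemma because the language may be uncountable. *)
Require Import Defs.
From Stdlib Require List.
From mathcomp Require Import all_boot.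
From mathcomp Require Import boolp classical_sets.

Set Implicit Arguments.
Unset Strict Implicit.
Unset Printing Implicit Defensive.

Local Open Scope classical_set_scope.

(** * Soundness on frames closed under binary intersections *)

Lemma sat_Imp (P : Type) (M : model P) (s : M) (phi psi : form P) :
  sat s (Imp phi psi) <-> (sat s phi -> sat s psi).
Proof.
split=> /= [sI s1|sI [s1 s2]]; last exact: s2 (sI s1).
by apply: contrapT => s2; apply: sI.
Qed.

Lemma sat_psubst (P : Type) (M : model P) (s : M) (sigma : nat -> form P)
    (a : pform) :
  sat s (psubst sigma a) <-> peval (fun i => `[< sat s (sigma i) >]) a.
Proof.
elim: a => [i|a IH|a IHa b IHb] /=; first by split=> /asboolP.
  by rewrite IH; split=> /negP.
by rewrite IHa IHb; split=> /andP.
Qed.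

Lemma ECW_sound (P : Type) : sound (@ECW P) c_frame.
Proof.
move=> phi; elim=> {phi}.
- by move=> a sigma ta M _ s; apply/sat_psubst; exact: ta.
- by move=> phi M _ s; apply/sat_Imp => -[].
- move=> phi psi M cM s; apply/sat_Imp => -[[N1 n1] [N2 n2]]; split.
    exact: cM N1 N2.
  by case=> /n1.
- move=> phi psi _ IH1 _ IH2 M cM s; move/sat_Imp: (IH2 M cM s).
  by apply; exact: IH1.
- move=> phi psi _ IH M cM s.
  (* The induction hypothesis covers all states of [M], so the two truth sets coincide globally;
     truth of a [Wop] formula depends on its argument only through that set. *)
  have E : [set t : M | sat t phi] = [set t : M | sat t psi].
    by apply/seteqP; split=> t; case: (IH M cM t) => /sat_Imp ? /sat_Imp.
  have EW : sat s (Wop phi) = sat s (Wop psi).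
    exact: (congr1 (fun X : set M => nbhd s X /\ ~ X s) E).
  by split; apply/sat_Imp; rewrite EW.
Qed.

(** * Propositional theorems *)

(** Shaped like [Imp], so that substitution instances match [Imp] by conversion. *)
Definition pimp (a b : pform) : pform := PNeg (PAnd a (PNeg b)).

Section Tautologies.
Variable P : Type.
Implicit Types phi psi chi : form P.

Let a := PVar 0.
Let b := PVar 1.
Let c := PVar 2.

Local Ltac tautology_instance x sigma :=
  apply: (@ECW_taut P x sigma);
  let v := fresh "v" in move=> v /=; by case: (v 0); case: (v 1); case: (v 2).

Lemma ECW_I phi : ECW (Imp phi phi).
Proof. tautology_instance (pimp a a) (nth phi [:: phi]). Qed.

Lemma ECW_K phi psi : ECW (Imp phi (Imp psi phi)).
Proof. tautology_instance (pimp a (pimp b a)) (nth phi [:: phi; psi]). Qed.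

Lemma ECW_S phi psi chi :
  ECW (Imp (Imp phi (Imp psi chi)) (Imp (Imp phi psi) (Imp phi chi))).
Proof.
tautology_instance (pimp (pimp a (pimp b c)) (pimp (pimp a b) (pimp a c)))
  (nth phi [:: phi; psi; chi]).
Qed.

Lemma ECW_explosion phi psi : ECW (Imp phi (Imp (Neg phi) psi)).
Proof.
tautology_instance (pimp a (pimp (PNeg a) b)) (nth phi [:: phi; psi]).
Qed.

Lemma ECW_cases phi psi : ECW (Imp (Imp phi psi) (Imp (Imp (Neg phi) psi) psi)).
Proof.
tautology_instance (pimp (pimp a b) (pimp (pimp (PNeg a) b) b))
  (nth phi [:: phi; psi]).
Qed.

Lemma ECW_AndI phi psi : ECW (Imp phi (Imp psi (And phi psi))).
Proof.
tautology_instance (pimp a (pimp b (PAnd a b))) (nth phi [:: phi; psi]).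
Qed.

Lemma ECW_AndE1 phi psi : ECW (Imp (And phi psi) phi).
Proof. tautology_instance (pimp (PAnd a b) a) (nth phi [:: phi; psi]). Qed.

Lemma ECW_AndE2 phi psi : ECW (Imp (And phi psi) psi).
Proof. tautology_instance (pimp (PAnd a b) b) (nth phi [:: phi; psi]). Qed.

End Tautologies.

(** * Derivability from hypotheses and Lindenbaum's lemma *)

(** Only modus ponens acts on hypotheses; [ECW_REW] enters through theorems alone, which keeps the
    deduction theorem valid. *)
Inductive derivable (P : Type) (Gamma : set (form P)) : form P -> Prop :=
| derivable_hyp (phi : form P) : Gamma phi -> derivable Gamma phi
| derivable_thm (phi : form P) : ECW phi -> derivable Gamma phi
| derivable_MP (phi psi : form P) :
    derivable Gamma phi -> derivable Gamma (Imp phi psi) -> derivable Gamma psi.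

Section Derivability.
Variable P : Type.
Implicit Types (Gamma Delta : set (form P)) (phi psi chi : form P).

Lemma derivable_sub Gamma Delta phi :
  Gamma `<=` Delta -> derivable Gamma phi -> derivable Delta phi.
Proof.
move=> sGD; elim=> {phi} [phi /sGD|phi|phi psi _ IH1 _ IH2].
- exact: derivable_hyp.
- exact: derivable_thm.
- exact: derivable_MP IH1 IH2.
Qed.

Lemma derivable_set0 phi : derivable set0 phi -> ECW phi.
Proof. by elim=> {phi} // phi psi _ IH1 _ IH2; exact: ECW_MP IH1 IH2. Qed.

Lemma derivable_ImpE Gamma phi psi :
  ECW (Imp phi psi) -> derivable Gamma phi -> derivable Gamma psi.
Proof. by move=> /derivable_thm tI d; apply: derivable_MP d (tI _). Qed.

Lemma deduction Gamma phi psi :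
  derivable (Gamma `|` [set phi]) psi -> derivable Gamma (Imp phi psi).
Proof.
elim=> {psi} [psi [Gpsi|->]|psi tpsi|psi chi _ IH1 _ IH2].
- exact: derivable_ImpE (ECW_K _ _) (derivable_hyp Gpsi).
- exact/derivable_thm/ECW_I.
- exact: derivable_ImpE (ECW_K _ _) (derivable_thm _ tpsi).
- exact: derivable_MP IH1 (derivable_ImpE (ECW_S _ _ _) IH2).
Qed.

(* [set0] is added to the chain so that the empty chain is no special case. *)
Lemma derivable_chain Gamma (F : set (set (form P))) phi :
  total_on F subset -> derivable (Gamma `|` \bigcup_(X in F) X) phi ->
  exists2 X, X = set0 \/ F X & derivable (Gamma `|` X) phi.
Proof.
move=> totF; elim=> {phi} [phi [Gphi|[X FX Xphi]]|phi tphi|].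
- by exists set0; [left|apply: derivable_hyp; left].
- by exists X; [right|apply: derivable_hyp; right].
- by exists set0; [left|apply: derivable_thm].
- move=> phi psi _ [X FX dX] _ [Y FY dY].
  have [sXY|sYX] : X `<=` Y \/ Y `<=` X.
    by case: FX FY => [->|FX] [->|FY]; [left|left|right|exact: totF].
  + exists Y => //; apply: derivable_MP dY.
    exact: derivable_sub (setUS sXY) dX.
  + exists X => //; apply: derivable_MP dX _.
    exact: derivable_sub (setUS sYX) dY.
Qed.

(** Maximal consistency is expressed by Boolean behaviour: the two directions of [mcs_Neg] are
    consistency and completeness, and closure under modus ponens follows by [mcs_Imp]. *)
Record maximal_consistent (s : set (form P)) : Prop := MaximalConsistent {
  mcs_thm : forall phi, ECW phi -> s phi;
  mcs_Neg : forall phi, s (Neg phi) <-> ~ s phi;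
  mcs_And : forall phi psi, s (And phi psi) <-> s phi /\ s psi }.

Lemma mcs_Imp s phi psi :
  maximal_consistent s -> s (Imp phi psi) <-> (s phi -> s psi).
Proof.
move=> ms; rewrite (mcs_Neg ms) (mcs_And ms) (mcs_Neg ms).
split=> [sI s1|sI [s1 s2]]; last exact: s2 (sI s1).
by apply: contrapT => s2; apply: sI.
Qed.

(** Zorn's lemma yields a maximal [A] such that [phi] is not derivable from [Gamma] and [A]
    together; the consequences of this union form [s]. Keeping [Gamma] outside the ordered sets lets
    the empty chain have the bound [set0]. *)
Lemma lindenbaum Gamma phi : ~ derivable Gamma phi ->
  exists s, [/\ maximal_consistent s, Gamma `<=` s & ~ s phi].
Proof.
move=> nd.
have [F FP totF|A [nA maxA]] :=
    @Zorn_bigcup _ [set X | ~ derivable (Gamma `|` X) phi].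
  case/(derivable_chain totF) => X [->|/FP //].
  by rewrite setU0.
exists [set psi | derivable (Gamma `|` A) psi]; split=> //=; last first.
  by move=> psi Gpsi; apply: derivable_hyp; left.
(* By maximality of [A], adding an underivable [psi] makes [phi] derivable. *)
have ext psi : ~ derivable (Gamma `|` A) psi ->
    derivable (Gamma `|` A) (Imp psi phi).
  move=> npsi; apply: deduction; rewrite -setUA; apply: contrapT.
  apply: maxA; split; first exact: subsetUl.
  by move=> /(_ psi (or_intror erefl)) Apsi; apply/npsi/derivable_hyp; right.
split=> [psi|psi|psi chi] /=; first exact: derivable_thm.
  split=> [dN d|/ext dI].
    exact: nA (derivable_MP dN (derivable_ImpE (ECW_explosion _ _) d)).
  (* If neither [psi] nor its negation were derivable, both would imply [phi], which would follow by
     cases. *)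
  apply: contrapT => /ext dN; apply: nA.
  exact: derivable_MP dN (derivable_ImpE (ECW_cases _ _) dI).
split=> [d|[d1 d2]].
  by split; move: d; apply: derivable_ImpE; [exact: ECW_AndE1|exact: ECW_AndE2].
exact: derivable_MP d2 (derivable_ImpE (ECW_AndI _ _) d1).
Qed.

(** Lindenbaum's lemma without hypotheses; it replaces later formal derivations by reasoning about
    membership. *)
Lemma ECW_mcs phi : (forall s, maximal_consistent s -> s phi) -> ECW phi.
Proof.
move=> all_s; apply: derivable_set0; apply: contrapT.
by case/lindenbaum => s [/all_s].
Qed.

Lemma mcs_BigAnd p0 s l : maximal_consistent s ->
  s (BigAnd p0 l) <-> (forall phi, List.In phi l -> s phi).
Proof.
move=> ms; elim: l => [|psi l IH] /=.
  by split=> // _; apply/(mcs_Neg ms) => /(mcs_And ms) [? /(mcs_Neg ms)].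
rewrite (mcs_And ms) IH; split=> [[spsi sl] phi [<-|/sl]//|sl].
by split=> [|phi lphi]; apply: sl; [left|right].
Qed.

Lemma derivable_finite p0 Gamma phi : derivable Gamma phi ->
  exists l, (forall gamma, List.In gamma l -> Gamma gamma) /\
    ECW (Imp (BigAnd p0 l) phi).
Proof.
move=> d.
(* Stated through maximal consistent sets, the modus ponens case only needs the concatenation of two
   lists, with no manipulation of [BigAnd]. *)
suff [l [lG lphi]] : exists l, (forall gamma, List.In gamma l -> Gamma gamma) /\
    forall s, maximal_consistent s ->
    (forall gamma, List.In gamma l -> s gamma) -> s phi.
  exists l; split=> //; apply: ECW_mcs => s ms.
  by apply/(mcs_Imp _ _ ms) => /(mcs_BigAnd _ _ ms); exact: lphi.
elim: d => {phi} [phi Gphi|phi tphi|phi psi _ [l [lG lP]] _ [k [kG kP]]].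
- exists [:: phi]; split=> [gamma [<-|]//|s _]; apply; by left.
- by exists [::]; split=> // s ms _; apply: mcs_thm.
- exists (l ++ k); split=> [gamma lkg|s ms slk].
    by case: (List.in_app_or _ _ _ lkg) => [/lG|/kG].
  have sphi : s phi by apply: lP => // g lg; apply/slk/List.in_or_app; left.
  move: sphi; apply/mcs_Imp => //; apply: kP => // g kg.
  by apply/slk/List.in_or_app; right.
Qed.

End Derivability.

(** * Canonical model and truth lemma *)

Section CanonicalModel.
Variables (P : Type) (s0 : set (form P)) (ms0 : maximal_consistent s0).

Definition canonical_state : Type := {s : set (form P) | maximal_consistent s}.

Definition proof_set (phi : form P) : set canonical_state :=
  [set t | sval t phi].

Lemma canonical_nonempty : [set: canonical_state] !=set0.
Proof. by exists (exist _ s0 ms0). Qed.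

Definition canonical_nbhd (s : canonical_state) : set (set canonical_state) :=
  [set X | exists2 phi, X = proof_set phi & sval s (Wop phi)].

Definition canonical_model : model P :=
  @Model P (Frame canonical_nonempty canonical_nbhd)
    (fun p => proof_set (Var p)).

Lemma canonical_c_frame : c_frame canonical_model.
Proof.
move=> s _ _ [phi -> sphi] [psi -> spsi]; exists (And phi psi).
  by apply/seteqP; split=> t /(mcs_And (svalP t)).
have /(mcs_Imp _ _ (svalP s)) := mcs_thm (svalP s) (ECW_WC phi psi).
by apply; apply/(mcs_And (svalP s)).
Qed.

(** Formulas with the same proof set are equivalent in every maximal consistent set, hence provably
    equivalent, and [ECW_REW] applies. *)
Lemma proof_set_Wop (s : canonical_state) (phi psi : form P) :
  proof_set phi = proof_set psi -> sval s (Wop phi) -> sval s (Wop psi).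
Proof.
move=> E; suff /ECW_REW/(mcs_thm (svalP s)) : ECW (Iff phi psi).
  by case/(mcs_And (svalP s)) => /(mcs_Imp _ _ (svalP s)).
apply: ECW_mcs => t mt.
have Et : proof_set phi (exist _ t mt) = proof_set psi (exist _ t mt).
  by rewrite E.
by apply/(mcs_And mt); split; apply/(mcs_Imp _ _ mt);
  move: Et; rewrite /proof_set /= => ->.
Qed.

Lemma truth_lemma (phi : form P) (s : canonical_model) :
  sat s phi <-> sval s phi.
Proof.
elim: phi s => [p|phi IH|phi IH1 psi IH2|phi IH] s //=.
- by rewrite IH (mcs_Neg (svalP s)).
- by rewrite IH1 IH2 (mcs_And (svalP s)).
have -> : [set t : canonical_model | sat t phi] = proof_set phi.
  by apply/seteqP; split=> t /IH.
(* The neighborhood comes with some [psi] that need not be [phi] but has the same proof set. *)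
split=> [[[psi E spsi] _]|sW]; first exact: proof_set_Wop (esym E) spsi.
split; first by exists phi.
(* [ECW_WE] supplies the second clause of the truth condition, that [phi] fails at [s]. *)
have /(mcs_Imp _ _ (svalP s)) := mcs_thm (svalP s) (ECW_WE phi).
by move=> /(_ sW) /(mcs_Neg (svalP s)); rewrite IH.
Qed.

End CanonicalModel.

Theorem proposition5p22 (P : Type) (p0 : P) :
  sound (@ECW P) c_frame /\ strongly_complete p0 (@ECW P) c_frame.
Proof.
split=> [|Gamma phi Gphi]; first exact: ECW_sound.
(* The set [s] both witnesses that the canonical frame is nonempty and is the state satisfying
   [Gamma] but refuting [phi]. *)
apply: derivable_finite; apply: contrapT => /lindenbaum[s [ms sG nphi]].
pose t : canonical_model ms := exist _ s ms.
apply/nphi/(truth_lemma phi t); apply: Gphi; first exact: canonical_c_frame.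
by move=> gamma /sG sgamma; apply/truth_lemma.
Qed.
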